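(* Let $h$ be continuous on $[0,M)$ and $(\overline E,\overline X(0),\overline\nu_0)\in\mathcal S_0$. Suppose $(\overline X,\overline\nu)$ solves the fluid equations associated with $(\overline E,\overline X(0),\overline\nu_0)$ and $h$, that is, for all $t\ge0$ and every continuously differentiable compactly supported $\varphi$ on $[0,M)\times\mathbb R_+$, $$\langle\varphi(\cdot,t),\overline\nu_t\rangle=\langle\varphi(\cdot,0),\overline\nu_0\rangle+\int_0^t\langle\varphi_s(\cdot,s)+\varphi_x(\cdot,s),\overline\nu_s\rangle ds-\int_0^t\langle h(\cdot)\varphi(\cdot,s),\overline\nu_s\rangle ds+\int_0^t\varphi(0,s)\,d\overline K(s),$$ $$\overline X(t)=\overline X(0)+\overline E(t)-\int_0^t\langle h,\overline\nu_s\rangle ds,$$ and the non-idling condition $1-\langle\mathbf 1,\overline\nu_t\rangle=[1-\overline X(t)]^+$ holds, where $\overline K,\overline D$ are the associated processes. Let $(\overline X',\overline\nu')$ be any càdlàg process with values in $\mathbb R_+\times\mathcal M_{\le1}[0,M)$, with associated processes $\overline K',\overline D'$ defined as $\overline K,\overline D$ with $\overline\nu$ replaced by $\overline\nu'$, that has the same data $(\overline E,\overline X(0),\overline\nu_0)$ (so $\overline X'(0)=\overline X(0)$ and $\overline\nu'_0=\overline\nu_0$), that satisfies, for all $t\ge0$ and every such $\varphi$, $$\langle\varphi(\cdot,t),\overline\nu'_t\rangle=\langle\varphi(\cdot,0),\overline\nu_0\rangle+\int_0^t\langle\varphi_s(\cdot,s)+\varphi_x(\cdot,s),\overline\nu'_s\rangle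 ds-\int_0^t\langle h(\cdot)\varphi(\cdot,s),\overline\nu'_s\rangle ds+\int_0^t\varphi(0,s)\,d\overline K'(s),$$ $$\overline X'(t)=\overline X(0)+\overline E(t)-\int_0^t\langle h,\overline\nu'_s\rangle ds,$$ and that satisfies $$\langle\mathbf 1,\overline\nu'_t\rangle\le\overline X'(t)\qquad\text{for }t\in[0,\infty)$$ (but not necessarily the non-idling condition $1-\langle\mathbf 1,\overline\nu'_t\rangle=[1-\overline X'(t)]^+$). Then for every $t\in[0,\infty)$, $\overline K(t)\ge\overline K'(t)$ and $\overline D(t)\ge\overline D'(t)$.
   Context: $G$ is a cumulative distribution function on $[0,\infty)$ with density $g$ and mean $1$; $M\doteq\sup\{x\ge0:G(x)<1\}\in(0,\infty]$; $h\doteq g/(1-G)$ on $[0,M)$ is the hazard rate. $\mathbb R_+=[0,\infty)$; $\mathbf 1$ is the constant function $1$; $\langle f,\xi\rangle\doteq\int_{[0,M)}f\,d\xi$. $\mathcal M_{\le1}[0,M)$ is the space of sub-probability measures on $[0,M)$ with the weak topology. $\mathcal I_{\mathbb R_+}[0,\infty)$ is the set of non-decreasing càdlàg $f:[0,\infty)\to\mathbb R_+$ with $f(0)=0$. $\mathcal S_0\doteq\{(f,x,\mu)\in\mathcal I_{\mathbb R_+}[0,\infty)\times\mathbb R_+\times\mathcal M_{\le1}[0,M):1-\langle\mathbf 1,\mu\rangle=[1-x]^+\}$. For a càdlàg $(\overline X,\overline\nu)$ with values in $\mathbb R_+\times\mathcal M_{\le1}[0,M)$ and data $(\overline E,\overline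 X(0),\overline\nu_0)\in\mathcal S_0$, the associated processes are $$\overline D(t)\doteq\int_0^t\langle h,\overline\nu_s\rangle ds,\qquad \overline K(t)\doteq\langle\mathbf 1,\overline\nu_t\rangle-\langle\mathbf 1,\overline\nu_0\rangle+\int_0^t\langle h,\overline\nu_s\rangle ds,$$ assumed finite for all $t$ (part of the fluid equations). The fluid equations associated with $(\overline E,\overline X(0),\overline\nu_0)$ and $h$ are the finiteness of $\overline D$ together with the following, for all $t\ge0$: for every continuously differentiable compactly supported $\varphi$ on $[0,M)\times\mathbb R_+$, $$\langle\varphi(\cdot,t),\overline\nu_t\rangle=\langle\varphi(\cdot,0),\overline\nu_0\rangle+\int_0^t\langle\varphi_s(\cdot,s)+\varphi_x(\cdot,s),\overline\nu_s\rangle ds-\int_0^t\langle h(\cdot)\varphi(\cdot,s),\overline\nu_s\rangle ds+\int_0^t\varphi(0,s)\,d\overline K(s)$$ (the last integral being a Riemann–Stieltjes integral over $[0,t]$); $\overline X(t)=\overline X(0)+\overline E(t)-\int_0^t\langle h,\overline\nu_s\rangle ds$; and the non-idling condition $1-\langle\mathbf 1,\overline\nu_t\rangle=[1-\overline X(t)]^+$. *)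

(* Defs.v *)
From HB Require Import structures.
From mathcomp Require Import all_boot all_order all_algebra.
From mathcomp Require Import all_classical all_reals all_analysis.
Set Implicit Arguments.
Unset Strict Implicit.
Unset Printing Implicit Defensive.
Import Order.TTheory GRing.Theory Num.Theory.
Import numFieldNormedType.Exports.

Local Open Scope classical_set_scope.
Local Open Scope ring_scope.

Section ServiceDistribution.
Context {R : realType}.
Implicit Types (G : cumulativeBounded (0 : R) (1 : R)) (g : R -> R).

Definition supported_nonneg G : Prop := forall x : R, x < 0 -> G x = 0.

Definition has_density G g : Prop :=
  [/\ measurable_fun setT g,
      forall x, 0 <= g x &
      forall A : set (measurableTypeR R), measurable A ->
        lebesgue_stieltjes_measure G A =
        (\int[lebesgue_measure]_(x in A) (g x)%:E)%E].

Definition has_mean_one G : Prop :=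
  (\int[lebesgue_stieltjes_measure G]_(x in `[0%R, +oo[) x%:E = 1)%E.

Definition right_end (G : R -> R) : \bar R :=
  ereal_sup [set x%:E | x in [set x : R | 0 <= x /\ G x < 1]].

Definition hazard (G g : R -> R) : R -> R := fun x => g x / (1 - G x).

End ServiceDistribution.

Section FluidModel.
Context {R : realType}.
Notation subprob := (subprobability (measurableTypeR R) R).
Implicit Types (M : \bar R) (h X E : R -> R) (nu : R -> subprob).
Implicit Types (xi : subprob).

Definition ages M : set R := [set x : R | 0 <= x /\ (x%:E < M)%E].

(* Sub-probability measures on [0, M) are represented by those on R that give
   no mass to the complement of [0, M). *)
Definition carried_by M xi : Prop := xi (~` ages M) = 0%E.

Definition bracket M (f : R -> R) xi : R := \int[xi]_(x in ages M) f x.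

Definition mass M xi : R := bracket M (fun=> 1) xi.

(* Functions of time are defined on R, but only their values on [0, +oo)
   matter. *)
Definition cadlag (f : R -> R) : Prop :=
  (forall t, 0 <= t -> f s @[s --> t^'+] --> f t) /\
  (forall t, 0 < t -> cvg (f s @[s --> t^'-])).

Definition weak_cvg M (F : set_system R) nu xi : Prop :=
  forall f : R -> R, {within ages M, continuous f} ->
    (exists B, forall x, ages M x -> `|f x| <= B) ->
    bracket M f (nu s) @[s --> F] --> bracket M f xi.

Definition weak_cadlag M nu : Prop :=
  (forall t, 0 <= t -> weak_cvg M (t^'+) nu (nu t)) /\
  (forall t, 0 < t ->
     exists xi, carried_by M xi /\ weak_cvg M (t^'-) nu xi).

(* Riemann-Stieltjes integral over [a, b]: the partition points are a :: p and
   the tag of the i-th subinterval is y i; the limit is taken as the mesh tends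
   to 0.  When a = b the only partition is the empty one. *)
Definition is_RS_integral (f K : R -> R) (a b I : R) : Prop :=
  forall eps : R, 0 < eps -> exists2 delta : R, 0 < delta &
  forall (p : seq R) (y : nat -> R),
    itv_partition a b p ->
    (forall i, (i < size p)%N ->
       [/\ nth b (a :: p) i <= y i, y i <= nth b (a :: p) i.+1 &
           nth b (a :: p) i.+1 - nth b (a :: p) i < delta]) ->
    `| \sum_(i < size p)
         f (y i) * (K (nth b (a :: p) i.+1) - K (nth b (a :: p) i)) - I | < eps.

Definition deriv_within (A : set R) (f : R -> R) (x l : R) : Prop :=
  (f y - f x) / (y - x) @[y --> within A (x^')] --> l.

Definition age_time M : set (R * R) := ages M `*` [set s : R | 0 <= s].

(* phi is a continuously differentiable compactly supported function on
   [0, M) x R_+, with partial derivatives phix in age and phis in time; the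
   derivatives are one-sided on the edges of the domain. *)
Definition test_function M (phi phix phis : R -> R -> R) : Prop :=
  [/\ forall x s, age_time M (x, s) ->
        deriv_within (ages M) (fun y => phi y s) x (phix x s) /\
        deriv_within [set r : R | 0 <= r] (phi x) s (phis x s),
      {within age_time M, continuous (fun z : R * R => phi z.1 z.2)},
      {within age_time M, continuous (fun z : R * R => phix z.1 z.2)},
      {within age_time M, continuous (fun z : R * R => phis z.1 z.2)} &
      exists C : set (R * R),
        [/\ compact C, C `<=` age_time M &
            forall x s, age_time M (x, s) -> ~ C (x, s) -> phi x s = 0]].

Definition eDproc M h nu (t : R) : \bar R :=
  (\int[lebesgue_measure]_(s in `[0%R, t])
     \int[nu s]_(x in ages M) (h x)%:E)%E.

Definition Dproc M h nu (t : R) : R := fine (eDproc M h nu t).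

Definition Kproc M h nu (t : R) : R :=
  mass M (nu t) - mass M (nu 0) + Dproc M h nu t.

Definition input_function E : Prop :=
  [/\ E 0 = 0, forall t, 0 <= t -> 0 <= E t,
      forall s t, 0 <= s -> s <= t -> E s <= E t & cadlag E].

Definition S0 M E (x0 : R) (nu0 : subprob) : Prop :=
  [/\ input_function E, 0 <= x0, carried_by M nu0 &
      1 - mass M nu0 = Num.max (1 - x0) 0].

Definition state_path M X nu : Prop :=
  [/\ forall t, 0 <= t -> 0 <= X t /\ carried_by M (nu t),
      cadlag X & weak_cadlag M nu].

Definition initial_state (x0 : R) (nu0 : subprob) X nu : Prop :=
  X 0 = x0 /\
  forall A : set (measurableTypeR R), measurable A -> nu 0 A = nu0 A.

Definition age_equation M h (nu0 : subprob) nu : Prop :=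
  forall phi phix phis : R -> R -> R, test_function M phi phix phis ->
  forall t : R, 0 <= t ->
  exists2 I : R, is_RS_integral (phi 0) (Kproc M h nu) 0 t I &
    bracket M (fun x => phi x t) (nu t) =
    bracket M (fun x => phi x 0) nu0
    + \int[lebesgue_measure]_(s in `[0, t])
        bracket M (fun x => phis x s + phix x s) (nu s)
    - \int[lebesgue_measure]_(s in `[0, t])
        bracket M (fun x => h x * phi x s) (nu s)
    + I.

Definition balance_equation M h E (x0 : R) X nu : Prop :=
  forall t, 0 <= t -> X t = x0 + E t - Dproc M h nu t.

Definition non_idling M X nu : Prop :=
  forall t, 0 <= t -> 1 - mass M (nu t) = Num.max (1 - X t) 0.

(* All the fluid equations except the non-idling condition. *)
Definition relaxed_fluid_solution M h E (x0 : R) (nu0 : subprob) X nu : Prop :=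
  [/\ state_path M X nu, initial_state x0 nu0 X nu,
      forall t, 0 <= t -> (eDproc M h nu t < +oo)%E,
      age_equation M h nu0 nu & balance_equation M h E x0 X nu].

Definition fluid_solution M h E (x0 : R) (nu0 : subprob) X nu : Prop :=
  relaxed_fluid_solution M h E x0 nu0 X nu /\ non_idling M X nu.

End FluidModel.

(* Main.v *)
Require Import Defs.
From HB Require Import structures.
From mathcomp Require Import all_boot all_order all_algebra.
From mathcomp Require Import all_classical all_reals all_analysis.
From mathcomp Require Import measurable_realfun.
From mathcomp Require Import ring lra.
Import Order.TTheory GRing.Theory Num.Theory.
Import numFieldNormedType.Exports.
Local Open Scope classical_set_scope.
Local Open Scope ring_scope.
Set Implicit Arguments.
Unset Strict Implicit.
Unset Printing Implicit Defensive.

(** Why the theorem holds.  Write dK and dD for the differences K - K' and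
    D - D' of the two solutions.

    Since K = mass - initial mass + D, the non-idling condition of the first
    solution and the bound mass <= X' of the second one give
    dK >= min (0, dD) at every time: either the first system is saturated,
    mass = 1 >= mass', or mass = X while mass' <= X' and X + D = X' + D'.

    Conversely dD is controlled by the past of dK.  Along characteristics the
    age equation says that a customer who entered service s time units ago is
    still there with probability 1 - G s, so that dD is the convolution of the
    density g with dK.  Hence, if dK >= 0 on [0, tau] and dK >= - m on [0, t]
    with t <= tau + d, then dD t >= - m G (2 d) (departure_gap_ge).  When
    G (2 d) < 1 the two facts together are a contraction for the negative part
    of dK on [tau, tau + d]; as dK is locally bounded below, that negative part
    vanishes on successive windows of length d (nonneg_of_contraction).

    The convolution identity itself is never needed.  The age equation is
    tested with the function trim e (S (x - s + t)) / S x times a time cutoff,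
    where S = 1 - G and trim e is a smooth truncation of the identity of
    [0, 1] that vanishes on [0, e].  Up to time t this function is annihilated
    by the transport operator (transport_test_killing), so what is left of the
    equation is the Riemann-Stieltjes integral of the monotone function
    s |-> trim e (S (t - s)) against K.  Summation by parts in its Riemann sums
    bounds the difference of the two integrals (is_RS_integral_bound), and
    letting e tend to 0 turns the left-hand side into the difference of the
    masses.  The truncation is there to make the support compact in
    [0, M) x R_+. *)

(** * Riemann-Stieltjes sums against a function bounded below *)

Section Stieltjes.
Context {R : realType}.
Implicit Types (f K L : R -> R) (a b t m : R).

Lemma is_RS_integralB f K L a b I J : is_RS_integral f K a b I ->
  is_RS_integral f L a b J -> is_RS_integral f (K \- L) a b (I - J).
Proof.
move=> hK hL e e0; have e20 : 0 < e / 2 by rewrite divr_gt0.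
have [d1 d10 h1] := hK _ e20; have [d2 d20 h2] := hL _ e20.
exists (Num.min d1 d2); first by rewrite lt_min d10.
move=> p y hp hy.
have := h1 p y hp; have := h2 p y hp.
move=> /(_ _)/wrap[|k2]; first by move=> i /hy[? ?]; rewrite lt_min => /andP[].
move=> /(_ _)/wrap[|k1]; first by move=> i /hy[? ?]; rewrite lt_min => /andP[].
rewrite (_ : _ - _ = (\sum_(i < size p) f (y i) *
    (K (nth b (a :: p) i.+1) - K (nth b (a :: p) i)) - I) -
  (\sum_(i < size p) f (y i) *
    (L (nth b (a :: p) i.+1) - L (nth b (a :: p) i)) - J)).
  by rewrite (le_lt_trans (ler_normB _ _))// [ltRHS](splitr e) ltrD.
rewrite (_ : \sum_(i < size p) _ = \sum_(i < size p) f (y i) *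
    (K (nth b (a :: p) i.+1) - K (nth b (a :: p) i)) -
  \sum_(i < size p) f (y i) *
    (L (nth b (a :: p) i.+1) - L (nth b (a :: p) i))); first by ring.
by rewrite -sumrB; apply: eq_bigr => i _ /=; ring.
Qed.

Lemma itv_partition_uniform t n : 0 < t ->
  itv_partition 0 t (mkseq (fun i => i.+1%:R * (t / n.+1%:R)) n.+1).
Proof.
move=> t0; split.
  apply/(pathP 0) => i; rewrite size_mkseq => ltin.
  rewrite nth_mkseq//; case: i ltin => [_|i ltin] /=.
    by rewrite mul1r divr_gt0.
  by rewrite nth_mkseq 1?ltnW// ltr_pM2r ?divr_gt0// ltr_nat.
rewrite -nth_last size_mkseq/= nth_mkseq//= mulrC divfK//.
Qed.

(** Summation by parts moves the increments onto the monotone integrand: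
    f (s_i) (L s_{i+1} - L s_i) is a telescoping term minus
    L s_{i+1} (f s_{i+1} - f s_i).  Only on the partition intervals that end
    after tau can this last term contribute positively, by at most m times the
    increment of f; they all lie in [t - 2 d, t] once the mesh is below d. *)
Lemma is_RS_integral_bound f L t tau d m I : 0 < t -> 0 < d -> t <= tau + d ->
  0 <= m -> (forall r s, r <= s -> s <= t -> f r <= f s) ->
  (forall s, 0 <= s -> s <= t -> - m <= L s) ->
  (forall s, 0 <= s -> s <= t -> s <= tau -> 0 <= L s) ->
  L 0 = 0 -> is_RS_integral f L 0 t I ->
  I <= f t * L t + m * (f t - f (t - d *+ 2)).
Proof.
move=> t0 d0 ttau m0 fmono Lm Ltau L0 hI.
apply/ler_addgt0Pr => e e0.
have [de de0 hde] := hI e e0.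
have md0 : 0 < Num.min de d by rewrite lt_min de0.
pose n := Num.truncn (t / Num.min de d).
pose w := t / n.+1%:R.
have w0 : 0 < w by rewrite divr_gt0.
have wd : w < Num.min de d.
  rewrite /w ltr_pdivrMr// mulrC -ltr_pdivrMr//.
  by rewrite truncnS_gt.
have nw : n.+1%:R * w = t by rewrite /w mulrC divfK.
have := hde _ (fun i => i%:R * w) (itv_partition_uniform n t0).
rewrite size_mkseq -/w.
have E i : (i <= n.+1)%N ->
    nth t (0 :: mkseq (fun i => i.+1%:R * w) n.+1) i = i%:R * w.
  case: i => [|i] hi /=; first by rewrite mul0r.
  by rewrite nth_mkseq.
move=> /(_ _)/wrap[i iltn|].
  rewrite !E//; last exact: ltnW.
  rewrite lexx ler_pM2r// ler_nat leqnSn; split => //.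
  rewrite -mulrBl -natrB// subSnn mul1r (lt_le_trans wd)//.
  by rewrite ge_min lexx.
move=> /ltr_normlP[+ _]; rewrite opprB ltrBlDr => /ltW /le_trans; apply.
rewrite addrC lerD2r.
(* Flattening f before t - 2 d keeps the increments that matter, and no
   interval has to be cut at tau. *)
pose flat s := f (Num.max s (t - d *+ 2)).
pose F i := f (i%:R * w) * L (i%:R * w) + m * flat (i%:R * w).
have Ft : F n.+1 = f t * L t + m * f t.
  rewrite /F nw /flat max_l// gerBl; lra.
have F0 : m * f (t - d *+ 2) <= F 0.
  rewrite /F mul0r L0 mulr0 add0r ler_wpM2l// fmono//.
    by rewrite le_max lexx orbT.
  by rewrite ge_max ltW//=; lra.
apply: (@le_trans _ _ (F n.+1 - F 0)); last by rewrite Ft mulrBr; lra.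
rewrite -(telescope_sumr _ (leq0n _)) big_mkord; apply: ler_sum => i _.
rewrite !E//; last exact: ltnW.
set r := i%:R * w; set s := i.+1%:R * w; rewrite /F -/r -/s.
have sr : s = r + w by rewrite /s /r -natr1 mulrDl mul1r.
have s0 : 0 <= s by rewrite mulr_ge0// ltW.
have st : s <= t by rewrite -nw ler_pM2r// ler_nat.
have wd' : w < d by rewrite (lt_le_trans wd)// ge_min lexx orbT.
have rs : r <= s by lra.
have frs := fmono _ _ rs st.
suff : - L s * (f s - f r) <= m * (flat s - flat r) by nra.
have [stau|taus] := leP s tau.
  apply: (@le_trans _ _ 0).
    by rewrite mulNr oppr_le0 mulr_ge0 ?subr_ge0// Ltau.
  rewrite mulr_ge0// subr_ge0 fmono//.
    by rewrite ge_max !le_max rs lexx orbT.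
  by rewrite ge_max st/=; lra.
rewrite /flat !max_l; [|lra|lra].
by rewrite ler_wpM2r ?subr_ge0// lerNl Lm.
Qed.
End Stieltjes.

(** * Smooth truncations *)

Section Calculus.
Context {R : realType}.
Implicit Types (f : R -> R) (A : set R) (x l v w e s t k : R).

Lemma is_derive_deriv_within A f x l :
  is_derive x 1 f l -> deriv_within A f x l.
Proof.
move/is_derive1_caratheodory => [q [fq cq <-]].
have cq' : q y @[y --> within A x^'] --> q x.
  apply: cvg_trans cq; apply: (@cvg_trans _ (q @ x^')).
    by apply: cvg_app; exact: cvg_within.
  by apply: cvg_app; exact: cvg_within.
apply: cvg_trans cq'; apply: near_eq_cvg.
apply: cvg_within; near=> y; rewrite fq mulfK// subr_eq0.
by near: y; exact: nbhs_dnbhs_neq.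
Unshelve. all: by end_near. Qed.

Definition pos2 x : R := Num.max x 0 ^+ 2.

Lemma continuous_max0 : continuous (fun x : R => Num.max x 0).
Proof.
move=> x; apply: (@continuous_max _ _ id (cst 0)); first exact: cvg_id.
exact: cvg_cst.
Qed.

Lemma pos2_ge0 x : 0 <= pos2 x. Proof. exact: sqr_ge0. Qed.

Lemma pos2_eq0 x : x <= 0 -> pos2 x = 0.
Proof. by move=> x0; rewrite /pos2 max_r// expr0n. Qed.

Lemma pos2E x : 0 <= x -> pos2 x = x ^+ 2.
Proof. by move=> x0; rewrite /pos2 max_l. Qed.

(** At 0 the slope function z |-> max z 0 is continuous and vanishes, which is
    Caratheodory's criterion. *)
Global Instance is_derive_pos2 x : is_derive x 1 pos2 (2 * Num.max x 0).
Proof.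
have [x0|x0|->] := ltgtP x 0.
- apply: (@near_eq_is_derive _ _ _ (cst 0)).
    by near=> y; rewrite pos2_eq0//; near: y; exact: lt_le_nbhsl.
  by rewrite mulr0; exact: is_derive_cst.
- apply: (@near_eq_is_derive _ _ _ (fun y : R => y ^+ 2)).
    by near=> y; rewrite pos2E//; near: y; exact: lt_le_nbhsr.
  apply: is_derive_eq.
  rewrite /GRing.scale/=; ring.
- apply/is_derive1_caratheodory; exists (fun y => Num.max y 0); split.
  + move=> z; rewrite (pos2_eq0 (lexx 0)) !subr0 /pos2.
    by have [z0|z0] := leP z 0; [rewrite expr0n mul0r|rewrite expr2].
  + exact: continuous_max0.
  + by rewrite maxxx mulr0.
Unshelve. all: by end_near. Qed.

(** Equal to 1 up to time t and to 0 from time t + k on; the inner [pos2] makes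
    the two ends flat, which keeps the function continuously differentiable. *)
Definition cutoff t k s : R := pos2 (1 - pos2 ((s - t) / k)).
Definition cutoff' t k s : R :=
  - (2 * Num.max (1 - pos2 ((s - t) / k)) 0) *
  (2 * Num.max ((s - t) / k) 0 / k).

Lemma cutoff_le t k s : 0 < k -> s <= t -> cutoff t k s = 1.
Proof.
move=> k0 st; rewrite /cutoff (@pos2_eq0 (_ / _)); last first.
  by rewrite ler_pdivrMr// mul0r subr_le0.
by rewrite subr0 pos2E// expr1n.
Qed.

Lemma cutoff'_le t k s : 0 < k -> s <= t -> cutoff' t k s = 0.
Proof.
move=> k0 st; rewrite /cutoff' (@max_r _ _ (_ / _)); last first.
  by rewrite ler_pdivrMr// mul0r subr_le0.
by rewrite mulr0 mul0r mulr0.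
Qed.

Lemma cutoff_ge t k s : 0 < k -> t + k <= s -> cutoff t k s = 0.
Proof.
move=> k0 st; rewrite /cutoff pos2_eq0// subr_le0.
have ? : 1 <= (s - t) / k by rewrite ler_pdivlMr// mul1r lerBrDl.
by rewrite pos2E ?expr_ge1// ?(le_trans ler01).
Qed.

Lemma is_derive_cutoff t k s : is_derive s 1 (cutoff t k) (cutoff' t k s).
Proof.
have h : is_derive s 1 (fun r => (r - t) / k) k^-1.
  rewrite [X in is_derive _ _ X _](_ : _ = k^-1 \*: (id - cst t)); last first.
    by apply/funext => r /=; rewrite mulrC.
  by apply: is_derive_eq; rewrite subr0 /GRing.scale/= mulr1.
have h1 : is_derive s 1 (fun r => pos2 ((r - t) / k))
    (2 * Num.max ((s - t) / k) 0 * k^-1).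
  exact: (@is_derive1_comp _ pos2 (fun r => (r - t) / k)).
have h2 : is_derive s 1 (fun r => 1 - pos2 ((r - t) / k))
    (0 - 2 * Num.max ((s - t) / k) 0 * k^-1) by apply: is_deriveB.
have := @is_derive1_comp _ pos2 (fun r => 1 - pos2 ((r - t) / k)) s _ _
  (is_derive_pos2 _) h2.
move=> h3; apply: is_derive_eq h3 _.
by rewrite /cutoff' sub0r mulrN mulNr mulrA.
Qed.

Lemma continuous_pos2 : continuous pos2.
Proof.
move=> x; apply/differentiable_continuous/derivable1_diffP.
exact: (@ex_derive _ _ _ _ _ _ _ (is_derive_pos2 x)).
Qed.

Lemma continuous_cutoff t k : continuous (cutoff t k).
Proof.
move=> x; apply/differentiable_continuous/derivable1_diffP.
exact: (@ex_derive _ _ _ _ _ _ _ (is_derive_cutoff t k x)).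
Qed.

Lemma continuous_cutoff' t k : continuous (cutoff' t k).
Proof.
have h : continuous (fun r => (r - t) / k).
  by move=> r; apply: cvgMl; apply: cvgB; [exact: cvg_id|exact: cvg_cst].
move=> s; apply: cvgM.
  apply: cvgN; apply: cvgMr.
  apply: (@continuous_comp _ _ _ (fun r => 1 - pos2 ((r - t) / k))
    (Num.max^~ 0)).
    apply: cvgB; first exact: cvg_cst.
    by apply: (@continuous_comp _ _ _ (fun r => (r - t) / k) pos2);
      [exact: h|exact: continuous_pos2].
  exact: continuous_max0.
apply: cvgMl; apply: cvgMr.
by apply: (@continuous_comp _ _ _ (fun r => (r - t) / k) (Num.max^~ 0));
  [exact: h|exact: continuous_max0].
Qed.

(** For v >= e this is v - 2 e + e ^ 2 / v, a smooth nondecreasing truncation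
    that lies below v and tends to v as e tends to 0. *)
Definition trim e v : R := pos2 (v - e) / v.
Definition trim' e v : R := 2 * Num.max (v - e) 0 / v - pos2 (v - e) / v ^+ 2.

Lemma trim_eq0 e v : v <= e -> trim e v = 0.
Proof. by move=> ve; rewrite /trim pos2_eq0 ?mul0r// subr_le0. Qed.

Lemma trim'_eq0 e v : v <= e -> trim' e v = 0.
Proof.
by move=> ve; rewrite /trim' pos2_eq0 ?max_r ?subr_le0// mulr0 !mul0r subrr.
Qed.

Lemma trim_ge0 e v : 0 <= v -> 0 <= trim e v.
Proof. by move=> v0; rewrite divr_ge0// pos2_ge0. Qed.

Lemma trim_le e v : 0 <= e -> 0 <= v -> trim e v <= v.
Proof.
move=> e0 v0; have [ve|ev] := leP v e; first by rewrite trim_eq0.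
have v1 : 0 < v by lra.
rewrite /trim pos2E; last lra.
by rewrite ler_pdivrMr//; nra.
Qed.

Lemma trim_mono e v w : 0 <= e -> v <= w -> trim e v <= trim e w.
Proof.
move=> e0 vw; have [ve|ev] := leP v e.
  rewrite (trim_eq0 ve); have [we|ew] := leP w e; first by rewrite trim_eq0.
  by rewrite trim_ge0; lra.
have v0 : 0 < v by lra.
have w0 : 0 < w by lra.
rewrite /trim !pos2E; [|lra|lra].
rewrite ler_pdivrMr// mulrAC ler_pdivlMr// -subr_ge0.
rewrite (_ : _ - _ = (w - v) * (v * w - e * e)); last by ring.
by rewrite mulr_ge0//; nra.
Qed.

Lemma is_derive_trim e v : v != 0 -> is_derive v 1 (trim e) (trim' e v).
Proof.
move=> v0.
have h : is_derive v 1 (fun r => r - e) (1 - 0) by apply: is_deriveB.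
have h1 : is_derive v 1 (fun r => pos2 (r - e))
    (2 * Num.max (v - e) 0 * (1 - 0)).
  exact: (@is_derive1_comp _ pos2 (fun r => r - e)).
have h2 : is_derive v 1 (fun r : R => r^-1) (- v ^- 2 *: 1).
  exact: (@is_deriveV _ id).
have := is_deriveM h1 h2.
move=> h3; apply: is_derive_eq h3 _.
rewrite /trim' /= /GRing.scale/=; field; exact: v0.
Qed.

Lemma continuous_trim' e v : v != 0 -> {for v, continuous (trim' e)}.
Proof.
move=> v0.
have h : continuous (fun r => r - e).
  by move=> r; apply: cvgB; [exact: cvg_id|exact: cvg_cst].
apply: cvgB; apply: cvgM.
- apply: cvgMr; apply: (@continuous_comp _ _ _ (fun r => r - e) (Num.max^~ 0)).
    exact: h.
  exact: continuous_max0.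
- by apply: cvgV => //; exact: cvg_id.
- apply: (@continuous_comp _ _ _ (fun r => r - e) pos2); first exact: h.
  exact: continuous_pos2.
- apply: cvgV; first by rewrite expf_neq0.
  by apply: (@exprn_continuous _ 2).
Qed.
End Calculus.

(** * The survival function *)

Section Survival.
Context {R : realType} (G : cumulativeBounded (0 : R) (1 : R)) (g : R -> R).
Hypotheses (hsupp : supported_nonneg G) (hdens : has_density G g).
Notation mu := lebesgue_measure.
Implicit Types (x y a b : R).

Let mg : measurable_fun setT g. Proof. by case: hdens. Qed.
Let g_ge0 x : 0 <= g x. Proof. by case: hdens. Qed.

Lemma cdf_mono : {homo G : x y / x <= y}.
Proof. exact: cumulative_is_nondecreasing. Qed.

Lemma cdf_ge0 x : 0 <= G x.
Proof.
have [x0|x0] := ltP x 0; first by rewrite hsupp.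
have := @cdf_mono (-1) x; rewrite (@hsupp (-1)) ?ltrN10//; apply; lra.
Qed.

Lemma cdf_le1 x : G x <= 1.
Proof.
rewrite leNgt; apply/negP => Gx.
have := @cumulativey _ _ _ G.
move=> /cvgrPdist_lt/(_ (G x - 1)); rewrite subr_gt0 => /(_ Gx) [A [_ hA]].
pose z := Num.max x (A + 1).
have /hA : A < z by rewrite lt_max ltrDl ltr01 orbT.
have : G x <= G z by rewrite cdf_mono// le_max lexx.
by move=> h /ltr_normlP[]; lra.
Qed.

Lemma integral_density_itv a b : a <= b ->
  (\int[mu]_(x in `]a, b]) (g x)%:E = (G b - G a)%:E)%E.
Proof.
move=> ab; case: hdens => _ _ <-; last exact: measurable_itv.
rewrite /lebesgue_stieltjes_measure /measure_extension/=.
rewrite measurable_mu_extE/=; last exact: is_ocitv.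
by rewrite wlength_itv_bnd.
Qed.

Lemma integrable_density a b : mu.-integrable `[a, b] (EFin \o g).
Proof.
apply: (@integrableS _ (measurableTypeR R) R mu `]a - 1, b]%classic) => //=.
  by apply: subset_itvr; rewrite bnd_simp ltrBlDr ltrDl.
apply/integrableP; split.
  by apply/measurable_EFinP; exact: measurable_funS mg.
under eq_integral do rewrite /= ger0_norm//.
have [ab|ab] := leP (a - 1) b; first by rewrite integral_density_itv// ltry.
by rewrite set_itv_ge ?integral_set0// bnd_simp -leNgt ltW.
Qed.

Lemma Rintegral_density a b : a <= b -> \int[mu]_(x in `[a, b]) g x = G b - G a.
Proof.
move=> ab; rewrite -Rintegral_itv_obnd_cbnd.
  by rewrite /Rintegral integral_density_itv.
apply: integrableS (integrable_density a b) => //.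
by apply: subset_itvr; rewrite bnd_simp.
Qed.

(** The distribution has no atom because it has a density. *)
Lemma continuous_cdf : continuous G.
Proof.
move=> x.
have : {within `[x - 1, x + 1],
    continuous (fun y => parameterized_integral mu (x - 1) y g)}.
  by apply: parameterized_integral_continuous; [lra|exact: integrable_density].
have lt : x - 1 < x + 1 by lra.
move/(continuous_within_itvP _ lt) => [+ _ _].
move=> /(_ x)/(_ _)/wrap[|cF].
  by rewrite in_itv/=; apply/andP; split; lra.
have : parameterized_integral mu (x - 1) y g + G (x - 1) @[y --> x] -->
    parameterized_integral mu (x - 1) x g + G (x - 1).
  by apply: cvgD; [exact: cF|exact: cvg_cst].
rewrite /parameterized_integral Rintegral_density ?subrK; last lra.
apply: cvg_trans; apply: near_eq_cvg; near=> y.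
rewrite Rintegral_density ?subrK//.
by near: y; apply: lt_le_nbhsr; lra.
Unshelve. all: by end_near. Qed.

Lemma cdf0 : G 0 = 0.
Proof.
have h : G y @[y --> (0:R)^'-] --> G 0.
  by apply: cvg_at_left_filter; exact: continuous_cdf.
have h0 : G y @[y --> (0:R)^'-] --> (0 : R).
  apply: cvg_near_cst; near=> y.
  by apply: hsupp; near: y; exact: nbhs_left_lt.
exact: (cvg_unique _ h h0).
Unshelve. all: by end_near. Qed.

(** By continuity G is still smaller than 1 a little beyond a point where it is,
    so the supremum M is not attained. *)
Lemma ages_right_end : ages (right_end G) = [set y | 0 <= y /\ G y < 1].
Proof.
apply/seteqP; split => y /= [y0 hy]; split => //.
  case/ereal_sup_gt: hy => _ [z [z0 Gz] <-]; rewrite lte_fin => yz.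
  by rewrite (le_lt_trans _ Gz)// cdf_mono// ltW.
have cG : G z @[z --> y] --> G y by exact: continuous_cdf.
have [e /= e0 he] := cvgr_lt _ cG _ hy.
have /he Gz : ball y e (y + e / 2).
  by rewrite /ball/= opprD addNKr normrN gtr0_norm; lra.
apply: (@lt_le_trans _ _ (y + e / 2)%:E); first by rewrite lte_fin; lra.
apply: ereal_sup_ubound; exists (y + e / 2) => //=; split => //; lra.
Qed.

Lemma cdf_max0_lt1 y : G y < 1 -> G (Num.max y 0) < 1.
Proof. by rewrite /Num.max; case: ifP => // _ _; rewrite cdf0. Qed.

(** 1 - G on [0, +oo), continued by its tangent at 0: the time cutoff of the
    test functions acts after time t, where they look at slightly negative
    ages, and 1 - G itself has a corner at 0 when g 0 > 0. *)
Definition surv (y : R) : R := 1 - G (Num.max y 0) - g 0 * Num.min y 0.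

Lemma surv_nneg y : 0 <= y -> surv y = 1 - G y.
Proof. by move=> y0; rewrite /surv max_l// min_r// mulr0 subr0. Qed.

Lemma surv_npos y : y <= 0 -> surv y = 1 - g 0 * y.
Proof. by move=> y0; rewrite /surv max_r// cdf0 subr0 min_l. Qed.

Lemma surv_gt0 y : G y < 1 -> 0 < surv y.
Proof.
have [y0|y0] := leP 0 y; first by rewrite surv_nneg// subr_gt0.
move=> _; rewrite surv_npos ?ltW//.
by have := g_ge0 0; nra.
Qed.

Hypothesis hcont : {within ages (right_end G), continuous (hazard G g)}.

Lemma hazardE y : G y < 1 -> g y = hazard G g y * (1 - G y).
Proof. by move=> Gy; rewrite /hazard divfK// lt0r_neq0// subr_gt0. Qed.

(** Continuity of the hazard rate carries over to g = h (1 - G) since G is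
    continuous. *)
Lemma continuous_density_max0 x : G x < 1 ->
  {for x, continuous (fun y : R => g (Num.max y 0))}.
Proof.
move=> Gx; have Gx' := cdf_max0_lt1 Gx.
have cG : (fun y : R => G (Num.max y 0)) @ x --> G (Num.max x 0).
  by apply: (@continuous_comp _ _ _ (fun y : R => Num.max y 0) G);
    [exact: continuous_max0|exact: continuous_cdf].
have nG : \forall y \near x, G (Num.max y 0) < 1.
  exact: cvgr_lt cG _ Gx'.
have : (fun y : R => hazard G g (Num.max y 0) * (1 - G (Num.max y 0))) @ x -->
    g (Num.max x 0).
  rewrite (hazardE Gx'); apply: cvgM; last by apply: cvgB; [exact: cvg_cst|].
  move/subspace_continuousP: hcont => /(_ (Num.max x 0))/(_ _)/wrap[|hx].
    by rewrite ages_right_end/=; split => //; rewrite le_max lexx orbT.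
  move=> A /hx.
  rewrite nbhs_simpl /within/= => hA.
  have := @continuous_max0 R x _ hA; rewrite nbhs_simpl/=.
  apply: filterS2 nG => y Gy; apply.
  by rewrite ages_right_end/=; split => //; rewrite le_max lexx orbT.
apply: cvg_trans; apply: near_eq_cvg; near=> y.
by rewrite [RHS]hazardE//; near: y.
Unshelve. all: by end_near. Qed.

Lemma integrable_density_max0 a b :
  mu.-integrable `[a, b] (EFin \o (fun y => g (Num.max y 0))).
Proof.
have ic : mu.-integrable `[a, b] (EFin \o cst (g 0)).
  apply/integrableP; split; first exact/measurable_EFinP.
  rewrite (eq_integral (cst (g 0)%:E)) => [|z _ /=]; last by rewrite ger0_norm.
  rewrite integral_cst//= lebesgue_measure_itv/=.
  by case: ifP => _; rewrite ?mule0// -EFinD -EFinM ltry.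
have mab : measurable (`[a, b] : set (measurableTypeR R)) by [].
have := integrableD mab (integrable_density a b) ic.
apply: le_integrable => //.
  apply/measurable_EFinP.
  have mm : measurable_fun `[a, b] (fun y : measurableTypeR R => Num.max y 0).
    by apply: measurable_maxr.
  exact: (measurableT_comp mg mm).
move=> y _ /=; rewrite lee_fin !ger0_norm ?addr_ge0//.
by rewrite /Num.max; case: ifP => _; rewrite ?lerDl ?lerDr.
Qed.

(** For x >= 0 the fundamental theorem of calculus is applied to
    y |-> g (max y 0) on an interval starting at -1; the extended density is
    continuous at 0, so no one-sided derivatives have to be glued. *)
Lemma is_derive_surv x : G x < 1 -> is_derive x 1 surv (- g (Num.max x 0)).
Proof.
move=> Gx; have [x0|x0] : x < 0 \/ 0 <= x by case: (ltP x 0); [left|right].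
  rewrite max_r ?ltW//.
  apply: (@near_eq_is_derive _ _ _ (fun y => 1 - g 0 * y)).
    by near=> y; rewrite surv_npos//; near: y; exact: lt_le_nbhsl.
  have h : is_derive x 1 (cst 1 - g 0 \*: id) (0 - g 0 *: 1).
    by apply: is_deriveB.
  by apply: is_derive_eq h _; rewrite sub0r /GRing.scale/= mulr1.
have x1 : x < x + 1 by lra.
have x2 : -1 < x by lra.
have [dF F'] := continuous_FTC1_closed x1
  (@integrable_density_max0 (-1) (x + 1)) x2 (continuous_density_max0 Gx).
set F := (F in derivable F) in dF F'.
have Fneg y : -1 <= y -> y <= 0 -> F y = g 0 * (y + 1).
  move=> y1 y0; rewrite /F (@eq_Rintegral _ _ _ _ _ (cst (g 0))).
    rewrite Rintegral_cst//= lebesgue_measure_itv/= lte_fin.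
    by case: ltgtP y1 => //= [_ _|<- _]; rewrite ?opprK// addNr.
  by move=> z; rewrite inE/= in_itv/= => /andP[_ zy]; rewrite max_r//; lra.
have FE y : -1 <= y -> surv y = 1 + g 0 - F y.
  move=> y1; have [y0|y0] := leP 0 y; last first.
    by have y0' := ltW y0; rewrite surv_npos// Fneg//; ring.
  have e : \int[mu]_(z in `]0, y]) g (Num.max z 0) = G y.
    rewrite (@eq_Rintegral _ (measurableTypeR R) R _ _ g).
      by rewrite /Rintegral integral_density_itv//= cdf0 subr0.
    by move=> z; rewrite inE/= in_itv/= => /andP[z0 _]; rewrite max_l// ltW.
  have m10 : -1 <= 0 :> R by lra.
  have := @Rintegral_itvB _ (fun y => g (Num.max y 0)) (BLeft (-1)) (BRight y)
    0 (integrable_density_max0 _ _).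
  rewrite !bnd_simp => /(_ m10 y0).
  rewrite e -/(F 0) -/(F y) (Fneg 0)// add0r mulr1 surv_nneg// => <-; ring.
have h : is_derive x 1 (cst (1 + g 0) - F) (0 - g (Num.max x 0)).
  apply: is_deriveB; rewrite -F' derive1E; exact/derivableP.
rewrite -sub0r; apply: near_eq_is_derive h.
by near=> y; rewrite FE//; near: y; exact: lt_le_nbhsr.
Unshelve. all: by end_near. Qed.
End Survival.

(** * Test functions transported along the characteristics *)

Section TestFunctions.
Context {R : realType} (G : cumulativeBounded (0 : R) (1 : R)) (g : R -> R).
Hypotheses (hsupp : supported_nonneg G) (hdens : has_density G g).
Hypothesis hcont : {within ages (right_end G), continuous (hazard G g)}.
Variable (e : R).
Hypotheses (e0 : 0 < e) (e1 : e < 1).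
Notation surv := (surv G g).
Implicit Types (x y s : R).

Lemma cdf_surjective (v : R) : 0 <= v -> v < 1 ->
  exists2 y : R, 0 <= y & G y = v.
Proof.
move=> v0 v1; have := @cumulativey _ _ _ G.
move=> /cvgrPdist_lt/(_ (1 - v)); rewrite subr_gt0 => /(_ v1) [A [_ hA]].
pose z := Num.max 0 (A + 1).
have z0 : 0 <= z by rewrite le_max lexx.
have /hA : A < z by rewrite lt_max ltrDl ltr01 orbT.
move=> /ltr_normlP[_ Gz].
have [||y] := @IVT _ G 0 z v z0.
- by apply: continuous_subspaceT; exact: continuous_cdf hdens.
- rewrite (cdf0 hsupp hdens) ge_min v0/= le_max; apply/orP; right; lra.
by rewrite in_itv/= => /andP[y0 _] <-; exists y.
Qed.

(** Beyond y everything is truncated at level e, and the gap up to z, which is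
    still inside [0, M), is the room in which the time cutoff can act. *)
Lemma survival_window : exists y z : R,
  [/\ 0 <= y, y < z, 1 - G y <= e & G z < 1].
Proof.
have e0' := e0; have e1' := e1.
have [||y y0 Gy] := @cdf_surjective (1 - e / 2); [lra..|].
have [||z z0 Gz] := @cdf_surjective (1 - e / 4); [lra..|].
exists y, z; split => //; [|lra..].
rewrite ltNge; apply/negP => /(@cdf_mono _ G) ?; lra.
Qed.

Definition trimmed_surv (y : R) : R := trim e (surv y).
Definition trimmed_surv' (y : R) : R := trim' e (surv y) * - g (Num.max y 0).

Lemma trimmed_surv_vanish y z : 0 <= y -> 1 - G y <= e -> y <= z -> surv z <= e.
Proof.
move=> y0 Gy yz; rewrite surv_nneg ?(le_trans y0)//.
by have := @cdf_mono _ G _ _ yz; lra.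
Qed.

(** The density is known to be continuous only where G < 1; at the remaining
    points [surv] is below the truncation level in a whole neighbourhood. *)
Lemma is_derive_trimmed_surv y : is_derive y 1 trimmed_surv (trimmed_surv' y).
Proof.
have [Gy|Gy] := ltP (G y) 1.
  apply: (@is_derive1_comp _ (trim e) surv); last exact: is_derive_surv.
  by apply: is_derive_trim; rewrite lt0r_neq0// surv_gt0.
have [a [b [a0 ab Ga Gb]]] := survival_window.
have ay : a < y.
  rewrite ltNge; apply/negP => /(@cdf_mono _ G) ?.
  by have ? := @cdf_mono _ G _ _ (ltW ab); lra.
rewrite /trimmed_surv' trim'_eq0 ?mul0r; last first.
  exact: trimmed_surv_vanish Ga (ltW ay).
apply: (@near_eq_is_derive _ _ _ (cst (0 : R))).
near=> z; rewrite /trimmed_surv trim_eq0//.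
apply: trimmed_surv_vanish Ga _ => //.
by near: z; exact: lt_le_nbhsr.
Unshelve. all: by end_near. Qed.

Lemma continuous_surv y : G y < 1 -> {for y, continuous surv}.
Proof.
move=> Gy; apply/differentiable_continuous/derivable1_diffP.
exact: (@ex_derive _ _ _ _ _ _ _ (is_derive_surv hsupp hdens hcont Gy)).
Qed.

Lemma continuous_trimmed_surv : continuous trimmed_surv.
Proof.
move=> y; apply/differentiable_continuous/derivable1_diffP.
exact: (@ex_derive _ _ _ _ _ _ _ (is_derive_trimmed_surv y)).
Qed.

Lemma continuous_trimmed_surv' : continuous trimmed_surv'.
Proof.
move=> y; have [Gy|Gy] := ltP (G y) 1.
  apply: cvgM; last first.
    by apply: cvgN; exact: (continuous_density_max0 hsupp hdens hcont Gy).
  apply: (@continuous_comp _ _ _ surv (trim' e)); first exact: continuous_surv.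
  by apply: continuous_trim'; rewrite lt0r_neq0// surv_gt0.
have [a [b [a0 ab Ga Gb]]] := survival_window.
have ay : a < y.
  rewrite ltNge; apply/negP => /(@cdf_mono _ G) ?.
  by have ? := @cdf_mono _ G _ _ (ltW ab); lra.
have z0 z : a <= z -> trimmed_surv' z = 0.
  move=> az; rewrite /trimmed_surv' trim'_eq0 ?mul0r//.
  exact: trimmed_surv_vanish Ga az.
rewrite /continuous_at z0 ?ltW//; apply: cvg_near_cst; near=> z.
by rewrite z0//; near: z; exact: lt_le_nbhsr.
Unshelve. all: by end_near. Qed.

Section Phi.
Variables (t k : R).
(** A function of x - s, hence constant along the characteristics, divided by
    S x to compensate the killing at rate h. *)
Definition transport_test (x s : R) : R :=
  trimmed_surv (x - s + t) * cutoff t k s / surv x.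
Definition transport_test_age (x s : R) : R :=
  trimmed_surv' (x - s + t) * cutoff t k s / surv x
  + trimmed_surv (x - s + t) * cutoff t k s * g (Num.max x 0) / surv x ^+ 2.
Definition transport_test_time (x s : R) : R :=
  (- trimmed_surv' (x - s + t) * cutoff t k s
   + trimmed_surv (x - s + t) * cutoff' t k s) / surv x.

Lemma is_derive_transport_test_age x s : G x < 1 ->
  is_derive x 1 (fun y => transport_test y s) (transport_test_age x s).
Proof.
move=> Gx; have sx : surv x != 0 by rewrite lt0r_neq0// surv_gt0.
have h0 : is_derive x 1 (fun y : R => y - s + t) (1 - 0 + 0).
  by apply: is_deriveD; apply: is_deriveB.
have h1 : is_derive x 1 (fun y => trimmed_surv (y - s + t))
    (trimmed_surv' (x - s + t) * (1 - 0 + 0)).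
  apply: (@is_derive1_comp _ trimmed_surv (fun y => y - s + t)) => //.
  exact: is_derive_trimmed_surv.
have h2 : is_derive x 1 (fun y => (surv y)^-1)
    (- surv x ^- 2 *: - g (Num.max x 0)).
  by apply: is_deriveV => //; exact: is_derive_surv.
have := is_deriveM (is_deriveM h1 (is_derive_cst (cutoff t k s) x 1)) h2.
move=> h; apply: is_derive_eq h _.
by rewrite /transport_test_age !fctE /GRing.scale/=; field.
Qed.

Lemma is_derive_transport_test_time x s :
  is_derive s 1 (transport_test x) (transport_test_time x s).
Proof.
have h0 : is_derive s 1 (fun r : R => x - r + t) (0 - 1 + 0).
  by apply: is_deriveD; apply: is_deriveB.
have h1 : is_derive s 1 (fun r => trimmed_surv (x - r + t))
    (trimmed_surv' (x - s + t) * (0 - 1 + 0)).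
  apply: (@is_derive1_comp _ trimmed_surv (fun r => x - r + t)) => //.
  exact: is_derive_trimmed_surv.
have := is_deriveM (is_deriveM h1 (is_derive_cutoff t k s))
   (is_derive_cst (surv x)^-1 s 1).
move=> h; apply: is_derive_eq h _.
rewrite /transport_test_time !fctE /GRing.scale/=; ring.
Qed.

Let cont1 (f : R -> R) (z : R * R) : {for z.1, continuous f} ->
  {for z, continuous (fun z : R * R => f z.1)}.
Proof.
by move=> cf; apply: (@continuous_comp _ _ _ fst f) => //; exact: cvg_fst.
Qed.

Let cont2 (f : R -> R) (z : R * R) : {for z.2, continuous f} ->
  {for z, continuous (fun z : R * R => f z.2)}.
Proof.
by move=> cf; apply: (@continuous_comp _ _ _ snd f) => //; exact: cvg_snd.
Qed.

Let cont12 (f : R -> R) (z : R * R) : continuous f ->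
  {for z, continuous (fun z : R * R => f (z.1 - z.2 + t))}.
Proof.
move=> cf; apply: (@continuous_comp _ _ _ (fun z : R * R => z.1 - z.2 + t) f);
  last exact: cf.
apply: cvgD; last exact: cvg_cst.
by apply: cvgB; [exact: cvg_fst|exact: cvg_snd].
Qed.

Let contV (z : R * R) : G z.1 < 1 ->
  {for z, continuous (fun z : R * R => (surv z.1)^-1)}.
Proof.
move=> Gz; apply: cvgV; first by rewrite lt0r_neq0// surv_gt0.
by apply: cont1; exact: continuous_surv.
Qed.

(** The support condition forces x - s + t <= y and s <= t + k, whence
    x <= y + k = z < M. *)
Lemma test_function_transport_test y z : 0 <= t -> 0 < k -> 0 <= y ->
  1 - G y <= e -> y + k = z -> G z < 1 ->
  test_function (right_end G)
    transport_test transport_test_age transport_test_time.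
Proof.
move=> t0 k0 y0 Gy ykz Gz.
have agesE x : ages (right_end G) x -> 0 <= x /\ G x < 1.
  by rewrite (ages_right_end hdens).
split.
- move=> x s [/= /agesE[x0 Gx] s0]; split; apply: is_derive_deriv_within.
    exact: is_derive_transport_test_age.
  exact: is_derive_transport_test_time.
- apply: continuous_in_subspaceT => u; rewrite inE => -[/= /agesE[x0 Gx] s0].
  apply: cvgM; last exact: contV.
  apply: cvgM; first by apply: cont12; exact: continuous_trimmed_surv.
  by apply: cont2; exact: continuous_cutoff.
- apply: continuous_in_subspaceT => u; rewrite inE => -[/= /agesE[x0 Gx] s0].
  apply: cvgD.
    apply: cvgM; last exact: contV.
    apply: cvgM; first by apply: cont12; exact: continuous_trimmed_surv'.
    by apply: cont2; exact: continuous_cutoff.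
  apply: cvgM.
    apply: cvgM.
      apply: cvgM; first by apply: cont12; exact: continuous_trimmed_surv.
      by apply: cont2; exact: continuous_cutoff.
    by apply: (cont1 (f := fun x => g (Num.max x 0)));
      exact: (continuous_density_max0 hsupp hdens hcont Gx).
  apply: cvgV; first by rewrite expf_neq0// lt0r_neq0// surv_gt0.
  under eq_fun do rewrite expr2.
  by rewrite expr2; apply: cvgM; apply: cont1; exact: continuous_surv.
- apply: continuous_in_subspaceT => u; rewrite inE => -[/= /agesE[x0 Gx] s0].
  apply: cvgM; last exact: contV.
  apply: cvgD.
    apply: cvgM.
      by apply: cvgN; apply: cont12; exact: continuous_trimmed_surv'.
    by apply: cont2; exact: continuous_cutoff.
  apply: cvgM; first by apply: cont12; exact: continuous_trimmed_surv.
  by apply: cont2; exact: continuous_cutoff'.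
- exists (`[0, z] `*` `[0, t + k]); split.
  + by apply: compact_setX; exact: segment_compact.
  + move=> [x s] [/=]; rewrite !in_itv/= => /andP[x0 xz] /andP[s0 _].
    split => //=; rewrite (ages_right_end hdens); split => //.
    by rewrite (le_lt_trans _ Gz)// cdf_mono.
  + move=> x s [/= /agesE[x0 Gx] s0] C.
    have [stk|/ltW tks] := leP s (t + k); last first.
      by rewrite /transport_test (cutoff_ge k0)// mulr0 mul0r.
    have zx : z < x.
      rewrite ltNge; apply/negP => xz; apply: C; split => /=.
        by rewrite in_itv/= x0.
      by rewrite in_itv/= s0.
    rewrite /transport_test /trimmed_surv trim_eq0 ?mul0r//.
    apply: trimmed_surv_vanish Gy _ => //; lra.
Qed.

(** This makes the two time integrals of the age equation cancel, whatever the
    solution is. *)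
Lemma transport_test_killing x s : 0 < k -> G x < 1 -> 0 <= x -> s <= t ->
  transport_test_time x s + transport_test_age x s =
  hazard G g x * transport_test x s.
Proof.
move=> k0 Gx x0 st.
rewrite /transport_test_time /transport_test_age /transport_test.
rewrite cutoff_le// cutoff'_le// max_l// /hazard surv_nneg//.
by field; rewrite lt0r_neq0// subr_gt0.
Qed.
End Phi.

End TestFunctions.

(** * Comparison of two solutions of the age equation *)

Lemma cvg_trim {R : realType} (u : R^nat) (v : R) : 0 < v ->
  u n @[n --> \oo] --> 0 -> trim (u n) v @[n --> \oo] --> v.
Proof.
move=> v0 u0; rewrite -[X in _ --> X](_ : pos2 (v - 0) / v = v); last first.
  by rewrite subr0 pos2E ?ltW// expr2 mulfK// lt0r_neq0.
apply: cvgMl; apply: (@cvg_comp _ _ _ (fun n => v - u n) pos2 _ (nbhs (v - 0))).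
  by apply: cvgB => //; exact: cvg_cst.
exact: continuous_pos2.
Qed.

Section Comparison.
Context {R : realType} (G : cumulativeBounded (0 : R) (1 : R)) (g : R -> R).
Hypotheses (hsupp : supported_nonneg G) (hdens : has_density G g).
Hypothesis hcont : {within ages (right_end G), continuous (hazard G g)}.
Notation subprob := (subprobability (measurableTypeR R) R).
Notation M := (right_end G).
Notation h := (hazard G g).
Implicit Types (e t d m : R) (xi : subprob).

Lemma measurable_ages : measurable (ages M : set (measurableTypeR R)).
Proof.
apply: is_interval_measurable => x y; rewrite (ages_right_end hdens)/=.
move=> [x0 Gx] [y0 Gy] z /andP[xz zy]; split; first exact: le_trans xz.
by rewrite (le_lt_trans _ Gy)// cdf_mono.
Qed.

Lemma mass_fine xi : mass M xi = fine (xi (ages M)).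
Proof.
by rewrite /mass /bracket Rintegral_cst ?mul1r//; exact: measurable_ages.
Qed.

Lemma mass_le1 xi : mass M xi <= 1.
Proof.
rewrite mass_fine -lee_fin fineK; last first.
  by rewrite fin_num_measure//; exact: measurable_ages.
apply: le_trans (@sprobability_setT _ _ _ xi).
by apply: le_measure; rewrite ?inE//; exact: measurable_ages.
Qed.

(** The value at time t of the test function [transport_test G g e t k]. *)
Definition weight e (x : R) : R := trimmed_surv G g e x / surv G g x.

(** The weights tend to 1 from below, so dominated convergence applies. *)
Lemma cvg_bracket_weight (u : R^nat) xi : (forall n, 0 < u n) ->
  (forall n, u n < 1) -> u n @[n --> \oo] --> 0 ->
  bracket M (weight (u n)) xi @[n --> \oo] --> mass M xi.
Proof.
move=> u0 u1 cu.
have s_gt0 x : ages M x -> 0 < surv G g x.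
  by rewrite (ages_right_end hdens) => -[_ Gx]; exact: surv_gt0.
have mA := measurable_ages.
have mf n : measurable_fun (ages M : set (measurableTypeR R))
    (EFin \o weight (u n)).
  apply/measurable_EFinP; apply: subspace_continuous_measurable_fun => //.
  apply: continuous_in_subspaceT => x; rewrite inE => Ax.
  apply: cvgM; first exact: continuous_trimmed_surv.
  apply: cvgV; first by rewrite lt0r_neq0// s_gt0.
  apply: continuous_surv => //.
  by move: Ax; rewrite (ages_right_end hdens) => -[].
have m1 : measurable_fun (ages M : set (measurableTypeR R))
    (EFin \o cst (1 : R)).
  exact/measurable_EFinP.
have i1 := finite_measure_integrable_cst xi (1 : R) mA.
have [||_ _ cI] := dominated_convergence mA mf m1 _ i1.
- apply: aeW => x Ax /=; apply: cvg_EFin; first by near=> n.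
  have x0 := s_gt0 _ Ax.
  rewrite -[X in _ --> X](mulfV (lt0r_neq0 x0)).
  by apply: cvgMl; apply: cvg_trim.
- apply: aeW => x n Ax /=; rewrite lee_fin ger0_norm.
    by rewrite ler_pdivrMr ?s_gt0// mul1r trim_le// ltW// s_gt0.
  by rewrite divr_ge0 ?trim_ge0// ltW// s_gt0.
rewrite /mass /bracket /Rintegral; apply: fine_cvg.
rewrite fineK; first exact: cI.
by rewrite integral_cst// mul1e fin_num_measure.
Unshelve. all: by end_near. Qed.

Lemma transport_test_equation e t k y z nu0 (nu : R -> subprob) :
  0 < e -> e < 1 -> 0 <= t -> 0 < k -> 0 <= y -> 1 - G y <= e ->
  y + k = z -> G z < 1 -> age_equation M h nu0 nu ->
  exists2 I, is_RS_integral (transport_test G g e t k 0) (Kproc M h nu) 0 t I &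
    bracket M (weight e) (nu t) =
    bracket M (fun x => transport_test G g e t k x 0) nu0 + I.
Proof.
move=> e0 e1 t0 k0 y0 Gy ykz Gz hage.
have htest :=
  test_function_transport_test hsupp hdens hcont e0 e1 t0 k0 y0 Gy ykz Gz.
have [I hI eqI] := hage _ _ _ htest t t0; exists I => //.
rewrite (_ : weight e = fun x => transport_test G g e t k x t); last first.
  by apply/funext => x; rewrite /transport_test subrK cutoff_le// mulr1.
rewrite eqI; congr (_ + _); rewrite -addrA -[RHS]addr0; congr (_ + _).
apply/eqP; rewrite subr_eq0; apply/eqP; apply: eq_Rintegral => s.
rewrite inE/= in_itv/= => /andP[s0 st]; apply: eq_Rintegral => x.
rewrite inE (ages_right_end hdens) => -[x0 Gx].
by rewrite transport_test_killing.
Qed.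

Lemma transport_test0 e t k s : 0 < k -> s <= t ->
  transport_test G g e t k 0 s = trimmed_surv G g e (t - s).
Proof.
move=> k0 st; rewrite /transport_test cutoff_le// surv_nneg//.
rewrite (cdf0 hsupp hdens) subr0 divr1 mulr1.
by rewrite sub0r addrC.
Qed.

Lemma Dproc0 (nu : R -> subprob) : Dproc M h nu 0 = 0.
Proof. by rewrite /Dproc /eDproc set_itv1 integral_set1. Qed.

Lemma Kproc0 (nu : R -> subprob) : Kproc M h nu 0 = 0.
Proof. by rewrite /Kproc Dproc0 subrr addr0. Qed.

Lemma Dproc_ge0 (nu : R -> subprob) t : 0 <= Dproc M h nu t.
Proof.
apply/fine_ge0/integral_ge0 => s _; apply: integral_ge0 => x _.
have [_ g0 _] := hdens.
by rewrite lee_fin divr_ge0// subr_ge0 cdf_le1.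
Qed.

Section TwoSolutions.
Variables (nu0 : subprob) (nu nu' : R -> subprob).
Hypotheses (hage : age_equation M h nu0 nu) (hage' : age_equation M h nu0 nu').
Hypothesis hinit : mass M (nu 0) = mass M (nu' 0).
Notation dK := (Kproc M h nu \- Kproc M h nu').
Notation dD := (Dproc M h nu \- Dproc M h nu').

(** Both solutions have the same initial measure, so the difference of the two
    tested age equations is an integral against dK alone. *)
Lemma bracket_weight_bound e t tau d m : 0 < e -> e < 1 -> 0 < t -> 0 < d ->
  t <= tau + d -> 0 <= m ->
  (forall s, 0 <= s -> s <= t -> - m <= dK s) ->
  (forall s, 0 <= s -> s <= t -> s <= tau -> 0 <= dK s) ->
  bracket M (weight e) (nu t) - bracket M (weight e) (nu' t) <=
    trim e 1 * dK t + m * (trim e 1 - trim e (1 - G (d *+ 2))).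
Proof.
move=> e0 e1 t0 d0 ttau m0 Km Ktau.
have [y [z [y0 yz Gy Gz]]] := survival_window hsupp hdens e0 e1.
have k0 : 0 < z - y by rewrite subr_gt0.
have ykz : y + (z - y) = z by rewrite addrC subrK.
have [I hI ->] := transport_test_equation e0 e1 (ltW t0) k0 y0 Gy ykz Gz hage.
have [I' hI' ->] :=
  transport_test_equation e0 e1 (ltW t0) k0 y0 Gy ykz Gz hage'.
rewrite opprD addrACA subrr add0r.
have d20 : 0 <= d *+ 2 by rewrite mulrn_wge0// ltW.
have := is_RS_integral_bound t0 d0 ttau m0 _ Km Ktau _ (is_RS_integralB hI hI').
have td : t - d *+ 2 <= t by rewrite gerBl.
rewrite /= !transport_test0// subrr subKr.
rewrite /trimmed_surv !surv_nneg// (cdf0 hsupp hdens) subr0; apply; last first.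
  by rewrite !Kproc0 subrr.
move=> r s rs st; rewrite !transport_test0//; last exact: le_trans st.
rewrite /trimmed_surv; apply: trim_mono; first exact: ltW.
have ts : 0 <= t - s by rewrite subr_ge0.
have tr : t - s <= t - r by rewrite lerB.
by rewrite !surv_nneg ?(le_trans ts)// lerB// cdf_mono.
Qed.

(** Letting e tend to 0 in [bracket_weight_bound] gives
    mass - mass' <= dK + m G (2 d), and dK - (mass - mass') is dD. *)
Lemma departure_gap_ge t tau d m : 0 <= t -> 0 < d -> G (d *+ 2) < 1 ->
  t <= tau + d -> 0 <= m ->
  (forall s, 0 <= s -> s <= t -> - m <= dK s) ->
  (forall s, 0 <= s -> s <= t -> s <= tau -> 0 <= dK s) ->
  - (m * G (d *+ 2)) <= dD t.
Proof.
move=> t_ge0 d0 Gd ttau m0 Km Ktau.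
move: t_ge0; rewrite le_eqVlt => /predU1P[<-|t0].
  by rewrite /= !Dproc0 subrr oppr_le0 mulr_ge0// (cdf_ge0 hsupp).
(* Halving the harmonic sequence keeps every truncation level below 1. *)
pose u n : R := harmonic n / 2.
have u0 n : 0 < u n by rewrite divr_gt0// invr_gt0.
have u1 n : u n < 1.
  rewrite /u ltr_pdivrMr// mul1r /harmonic/= (le_lt_trans (y := 1))//.
    by rewrite invf_le1// ler1n.
  by rewrite ltr1n.
have cu : u n @[n --> \oo] --> 0.
  by rewrite -(mul0r (2^-1)); apply: cvgMl; exact: cvg_harmonic.
have ct (v : R) : 0 < v -> trim (u n) v @[n --> \oo] --> v.
  by move=> v0; apply: cvg_trim.
have c1 := ct _ ltr01.
have Gd' : 0 < 1 - G (d *+ 2) by rewrite subr_gt0.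
have c2 := ct _ Gd'.
have : mass M (nu t) - mass M (nu' t) <=
    1 * dK t + m * (1 - (1 - G (d *+ 2))).
  apply: (@ler_cvg_to _ \oo _ _
    (fun n => bracket M (weight (u n)) (nu t)
      - bracket M (weight (u n)) (nu' t))
    (fun n => trim (u n) 1 * dK t
      + m * (trim (u n) 1 - trim (u n) (1 - G (d *+ 2))))).
  - by apply: cvgB; apply: (@cvg_bracket_weight u).
  - apply: cvgD; first exact: cvgMl.
    by apply: cvgMr; exact: cvgB.
  - by apply: nearW => n; apply: bracket_weight_bound Km Ktau.
rewrite /= /Kproc hinit; lra.
Qed.
End TwoSolutions.
End Comparison.

(** * Iteration over time windows *)

(** On each window of length d the lower bound - B on L improves to - B q, then
    - B q ^ 2 and so on, hence to 0; the next window can then be treated. *)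
Lemma nonneg_of_contraction {R : realType} (L D : R -> R) (d q B T : R) :
  0 < d -> 0 <= q -> q < 1 -> 0 <= B ->
  (forall s, 0 <= s -> s <= T -> Num.min 0 (D s) <= L s) ->
  (forall s, 0 <= s -> s <= T -> - B <= D s) ->
  (forall s tau m, 0 <= s -> s <= T -> s <= tau + d -> 0 <= m ->
    (forall r, 0 <= r -> r <= s -> - m <= L r) ->
    (forall r, 0 <= r -> r <= s -> r <= tau -> 0 <= L r) ->
    - (m * q) <= D s) ->
  L 0 = 0 -> forall s, 0 <= s -> s <= T -> 0 <= L s.
Proof.
move=> d0 q0 q1 B0 hmin hB hstep L0.
have LB m s : 0 <= s -> s <= T -> 0 <= m -> - m <= D s -> - m <= L s.
  move=> s0 sT m0 Dm; apply: le_trans (hmin _ s0 sT).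
  by rewrite le_min Dm oppr_le0 m0.
have claim n s : 0 <= s -> s <= T -> s <= n%:R * d -> 0 <= L s.
  elim: n s => [s s0 _ | n IH s s0 sT sn].
    rewrite mul0r => s0'; rewrite (_ : s = 0) ?L0//.
    by apply/eqP; rewrite eq_le s0 s0'.
  have decay j r : 0 <= r -> r <= s -> - (B * q ^+ j) <= L r.
    elim: j r => [r r0 rs|j IHj r r0 rs].
      by rewrite expr0 mulr1; apply: LB (hB _ _ _) => //; exact: le_trans sT.
    apply: LB; rewrite ?(le_trans rs)// ?mulr_ge0 ?exprn_ge0//.
    rewrite exprSr mulrA; apply: (hstep _ (n%:R * d)) => //.
    - exact: le_trans sT.
    - by rewrite (le_trans rs)// (le_trans sn)// -natr1 mulrDl mul1r.
    - by rewrite mulr_ge0// exprn_ge0.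
    - by move=> r' r'0 r'r; rewrite IHj// (le_trans r'r).
    - by move=> r' r'0 r'r r'n; rewrite IH// (le_trans r'r)// (le_trans rs).
  have q1' : `|q| < 1 by rewrite ger0_norm.
  have c : - (B * q ^+ j) @[j --> \oo] --> 0.
    rewrite -(oppr0 R) -(mulr0 B); apply: cvgN; apply: cvgMr.
    exact: cvg_expr.
  apply: (cvgr_to_le c); apply: nearW => j; exact: decay.
move=> s s0 sT; apply: (claim (Num.truncn (s / d)).+1) => //.
by rewrite -ler_pdivrMr// ltW// truncnS_gt.
Qed.

Unset Implicit Arguments.
Set Strict Implicit.
Set Printing Implicit Defensive.

Theorem lemma4p7 (R : realType) (G : cumulativeBounded (0 : R) (1 : R))
    (g : R -> R) (E X X' : R -> R) (x0 : R)
    (nu0 : subprobability (measurableTypeR R) R)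
    (nu nu' : R -> subprobability (measurableTypeR R) R)
    (hsupp : supported_nonneg G) (hdens : has_density G g)
    (hmean : has_mean_one G)
    (hcont : {within ages (right_end G), continuous (hazard G g)})
    (hdata : S0 (right_end G) E x0 nu0)
    (hsol : fluid_solution (right_end G) (hazard G g) E x0 nu0 X nu)
    (hsol' : relaxed_fluid_solution (right_end G) (hazard G g) E x0 nu0 X' nu')
    (hle : forall t : R, 0 <= t -> mass (right_end G) (nu' t) <= X' t)
    (t : R) (ht : 0 <= t) :
  Kproc (right_end G) (hazard G g) nu' t <= Kproc (right_end G) (hazard G g) nu t /\
  Dproc (right_end G) (hazard G g) nu' t <= Dproc (right_end G) (hazard G g) nu t.
Proof.
have [[_ [_ hnu0] _ hage hX] hidle] := hsol.
have [[hX'0 _ _] [_ hnu0'] _ hage' hX'] := hsol'.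
have [[_ E0 Emono _] x00 _ _] := hdata.
have mA := measurable_ages hdens.
have hinit : mass (right_end G) (nu 0) = mass (right_end G) (nu' 0).
  by rewrite !(mass_fine hdens) hnu0// hnu0'.
set K := Kproc _ _ nu; set K' := Kproc _ _ nu'.
set D := Dproc _ _ nu; set D' := Dproc _ _ nu'.
pose L := K \- K'; pose dD := D \- D'.
have [a [b [a0 ab _ Gb]]] : exists y z : R,
    [/\ 0 <= y, y < z, 1 - G y <= 2^-1 & G z < 1].
  by apply: (survival_window hsupp hdens); lra.
pose d := b / 2.
have d2 : d *+ 2 = b by rewrite -mulr_natr divfK.
have d0 : 0 < d by rewrite divr_gt0//; lra.
have Gd : G (d *+ 2) < 1 by rewrite d2.
have hstep s tau m : 0 <= s -> s <= t -> s <= tau + d -> 0 <= m ->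
    (forall r, 0 <= r -> r <= s -> - m <= L r) ->
    (forall r, 0 <= r -> r <= s -> r <= tau -> 0 <= L r) ->
    - (m * G (d *+ 2)) <= dD s.
  move=> s0 _ std m0 Lm Ltau.
  exact: (departure_gap_ge hsupp hdens hcont hage hage' hinit s0 d0 Gd std m0
    Lm Ltau).
(* Either mass = 1 >= mass', or mass = X and mass' <= X'. *)
have hmin s : 0 <= s -> s <= t -> Num.min 0 (dD s) <= L s.
  move=> s0 st; rewrite ge_min.
  have := hidle _ s0; have := hX _ s0; have := hX' _ s0; have := hle _ s0.
  have := mass_le1 hdens (nu' s).
  rewrite /L /dD /= /K /K' /Kproc -/D -/D' hinit => m1 mX' eX' eX.
  have [X1|X1] := leP (1 - X s) 0 => em; apply/orP; [right|left]; lra.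
(* X' >= 0 bounds D' by all the mass that has ever been available. *)
have hB s : 0 <= s -> s <= t -> - (x0 + E t) <= dD s.
  move=> s0 st; have [X's _] := hX'0 _ s0.
  have := hX' _ s0; have := Emono _ _ s0 st.
  have := Dproc_ge0 hdens nu s.
  by rewrite /dD /= -/D -/D'; lra.
have L0 : L 0 = 0 by rewrite /L /= /K /K' !Kproc0 subrr.
have B0 : 0 <= x0 + E t by rewrite addr_ge0// E0.
have Lge0 := nonneg_of_contraction d0 (cdf_ge0 hsupp _) Gd B0 hmin hB hstep L0.
split; first by rewrite -subr_ge0; exact: Lge0.
(* With dK >= 0 everywhere the gap estimate holds with m = 0. *)
rewrite -subr_ge0 -[leLHS]oppr0 -[in leLHS](mul0r (G (d *+ 2))).
apply: (hstep _ t) => //.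
- by rewrite lerDl ltW.
- by move=> r r0 rt; rewrite oppr0 Lge0.
- by move=> r r0 rt _; exact: Lge0.
Qed.
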